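(* Let $n\ge 1$ and let $G$ be a self-complementary graph on $n$ vertices. Then $G$ contains the complete graph $K_{\lfloor \frac{n+1}{2}\rfloor}$ as a minor.
   Context: All graphs are finite, simple (no loops, no multiple edges) and undirected. The complement $cG$ of a graph $G$ on $n$ vertices has the same vertex set, with $uv$ an edge of $cG$ iff $u\ne v$ and $uv$ is not an edge of $G$. $G$ is self-complementary if it is isomorphic to $cG$. A minor of $G$ is any graph obtained from $G$ by a sequence of edge deletions, vertex deletions and edge contractions (contracting an edge identifies its endpoints and removes resulting loops and multiple edges). *)

(* Defs.v *)
From mathcomp Require Import all_boot.

Set Implicit Arguments.
Unset Strict Implicit.
Unset Printing Implicit Defensive.

Record sgraph := SGraph {
  vertex :> finType;
  adj : rel vertex;
  adj_sym : symmetric adj;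
  adj_irrefl : irreflexive adj
}.

Definition isomorphic (G H : sgraph) : Prop :=
  exists2 f : G -> H, bijective f & forall x y, adj (f x) (f y) = adj x y.

Section Complement.
Variable G : sgraph.

Definition compl_rel : rel G := fun x y => (x != y) && ~~ adj x y.

Lemma compl_rel_sym : symmetric compl_rel.
Proof. by move=> x y; rewrite /compl_rel eq_sym adj_sym. Qed.

Lemma compl_rel_irrefl : irreflexive compl_rel.
Proof. by move=> x; rewrite /compl_rel eqxx. Qed.

Definition compl : sgraph := SGraph compl_rel_sym compl_rel_irrefl.

End Complement.

Definition self_complementary (G : sgraph) : Prop := isomorphic G (compl G).

Section Complete.
Variable m : nat.

Definition complete_rel : rel 'I_m := fun x y => x != y.

Lemma complete_rel_sym : symmetric complete_rel.
Proof. by move=> x y; rewrite /complete_rel eq_sym. Qed.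

Lemma complete_rel_irrefl : irreflexive complete_rel.
Proof. by move=> x; rewrite /complete_rel eqxx. Qed.

Definition complete : sgraph := SGraph complete_rel_sym complete_rel_irrefl.

End Complete.

Section EdgeDeletion.
Variables (G : sgraph) (u v : G).

Definition del_edge_rel : rel G := fun x y =>
  adj x y && ~~ (((x == u) && (y == v)) || ((x == v) && (y == u))).

Lemma del_edge_rel_sym : symmetric del_edge_rel.
Proof.
move=> x y; rewrite /del_edge_rel adj_sym orbC.
by rewrite (andbC (x == v)) (andbC (x == u)).
Qed.

Lemma del_edge_rel_irrefl : irreflexive del_edge_rel.
Proof. by move=> x; rewrite /del_edge_rel adj_irrefl. Qed.

Definition del_edge : sgraph := SGraph del_edge_rel_sym del_edge_rel_irrefl.

End EdgeDeletion.

Section VertexDeletion.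
Variables (G : sgraph) (v : G).

Definition del_vertex_rel : rel {x : G | x != v} :=
  fun x y => adj (val x) (val y).

Lemma del_vertex_rel_sym : symmetric del_vertex_rel.
Proof. by move=> x y; rewrite /del_vertex_rel adj_sym. Qed.

Lemma del_vertex_rel_irrefl : irreflexive del_vertex_rel.
Proof. by move=> x; rewrite /del_vertex_rel adj_irrefl. Qed.

Definition del_vertex : sgraph :=
  SGraph del_vertex_rel_sym del_vertex_rel_irrefl.

End VertexDeletion.

(* The vertex obtained by identifying u and v is represented by u, so the    *)
(* contracted graph lives on the vertices other than v.                      *)
Section Contraction.
Variables (G : sgraph) (u v : G).

Definition merge (x : G) : G := if x == v then u else x.

Definition contract_rel : rel {x : G | x != v} := fun x y =>
  (x != y) &&
  [exists a : G, exists b : G,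
     [&& adj a b, merge a == val x & merge b == val y]].

Lemma contract_rel_sym : symmetric contract_rel.
Proof.
move=> x y; rewrite /contract_rel eq_sym; congr (_ && _).
by apply/existsP/existsP => -[a /existsP[b /and3P[ab ax By]]];
   exists b; apply/existsP; exists a; rewrite adj_sym ab ax By.
Qed.

Lemma contract_rel_irrefl : irreflexive contract_rel.
Proof. by move=> x; rewrite /contract_rel eqxx. Qed.

Definition contract : sgraph := SGraph contract_rel_sym contract_rel_irrefl.

End Contraction.

Inductive minor_step (G : sgraph) : sgraph -> Prop :=
| StepDelEdge (u v : G) : adj u v -> minor_step G (del_edge u v)
| StepDelVertex (v : G) : minor_step G (del_vertex v)
| StepContract (u v : G) : adj u v -> minor_step G (contract u v).

(* Graphs are compared up to isomorphism at the end of the sequence. *)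
Inductive has_minor (G H : sgraph) : Prop :=
| MinorIso : isomorphic G H -> has_minor G H
| MinorStep (G' : sgraph) : minor_step G G' -> has_minor G' H -> has_minor G H.

(* Main.v *)
Require Import Defs.
From mathcomp Require Import all_boot.
From mathcomp Require Import zify.

(** Let [s] be an isomorphism from [G] to its complement. For distinct [x], [y]
    exactly one of [xy], [(s x)(s y)] is an edge. Hence any two distinct sets
    [{x, s x}], [{y, s y}] are joined by an edge, and along every nontrivial
    cycle of [s] the pairs [{x, s x}] are alternately edges and non-edges. The
    pairs that are edges thus partition the non-fixed vertices, and [s] has at
    most one fixed point; contracting these edges yields a complete graph on
    [ceil (n / 2)] vertices. *)

Set Implicit Arguments.
Unset Strict Implicit.
Unset Printing Implicit Defensive.

(** Induction on the order of [G]: two vertices in one fibre of [f] are adjacent, so their edge can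
    be contracted, and [f] descends with all its hypotheses. Once [f] is injective it is an
    isomorphism. *)
Lemma has_minor_clique_quotient (G H : sgraph) (f : G -> H) :
    (forall a, exists x, f x = a) ->
    (forall x y, f x = f y -> x != y -> adj x y) ->
    (forall a b, adj a b <->
       a <> b /\ exists x y, [/\ f x = a, f y = b & adj x y]) ->
  has_minor G H.
Proof.
have [k] := ubnP #|G|; elim: k => // k IHk in G f * => ltGk fS fC fA.
have [/injectiveP f_inj | /injectivePn[u [v neq_uv fuv]]] := boolP (injectiveb f).
  apply: MinorIso; exists f.
    apply: inj_card_bij => //; rewrite -(card_codom f_inj).
    by apply/subset_leq_card/subsetP => a _; have [x <-] := fS a; apply: codom_f.
  move=> x y; apply/idP/idP => [/fA[_ [x' [y' [/f_inj-> /f_inj-> //]]]] | xy].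
  apply/fA; split; last by exists x, y.
  by move=> /f_inj exy; rewrite exy adj_irrefl in xy.
have uv := fC _ _ fuv neq_uv.
apply: MinorStep (StepContract uv) _.
have f_merge x : f (Defs.merge u v x) = f x by rewrite /Defs.merge; case: eqP => // ->.
have mergeP x : Defs.merge u v x != v by rewrite /Defs.merge; case: ifPn.
have merge_val (x : contract u v) : Defs.merge u v (val x) = val x.
  by rewrite /Defs.merge (negPf (valP x)).
pose m x : contract u v := exist _ (Defs.merge u v x) (mergeP x).
apply: (IHk (contract u v) (fun x => f (val x))).
- rewrite card_sig; rewrite ltnS in ltGk; apply: leq_trans ltGk.
  rewrite (cardD1 v G) inE add1n ltnS; apply/subset_leq_card/subsetP => x.
  by rewrite !inE andbT.
- by move=> a; have [x <-] := fS a; exists (m x); rewrite /= f_merge.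
- move=> x y fxy neq_xy; rewrite /= /contract_rel neq_xy /=.
  apply/existsP; exists (val x); apply/existsP; exists (val y).
  by rewrite !merge_val !eqxx !andbT fC.
- move=> a b; split=> [/fA[neq_ab [x [y [fx fy xy]]]] | ].
    (* [m] is the contraction map; it preserves the value of [f]. *)
    split=> //; exists (m x), (m y); rewrite /= !f_merge; split=> //.
    rewrite /contract_rel; apply/andP; split.
      by apply/eqP => /(congr1 (fun z => f (val z))) /=; rewrite !f_merge fx fy.
    by apply/existsP; exists x; apply/existsP; exists y; rewrite xy !eqxx.
  case=> neq_ab [x [y [fx fy /andP[_ /existsP[x' /existsP[y']]]]]].
  case/and3P=> xy' /eqP ex /eqP ey; apply/fA; split=> //; exists x', y'.
  by rewrite -fx -fy -ex -ey !f_merge.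
Qed.

Section Antimorphism.

Variables (G : sgraph) (s g : G -> G).
Hypotheses (sK : cancel s g) (gK : cancel g s).
Hypothesis s_compl : forall x y, compl_rel (s x) (s y) = adj x y.

Let s_inj : injective s := can_inj sK.

(** One representative of each class to be contracted; a fixed point of [s] is a class by itself. *)
Definition edge_source : {set G} := [set x | (s x == x) || adj x (s x)].

(** Projection onto the representatives: by alternation along a cycle of [s], the predecessor of a
    vertex outside [edge_source] lies inside. *)
Definition source (x : G) : G := if x \in edge_source then x else g x.

Lemma adj_antimorphism x y : x != y -> adj (s x) (s y) = ~~ adj x y.
Proof.
by move=> neq_xy; rewrite -(s_compl x y) /compl_rel (inj_eq s_inj) neq_xy negbK.
Qed.

Lemma antimorphism_edge_source x :
  s x != x -> (s x \in edge_source) = (x \notin edge_source).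
Proof.
move=> sx; rewrite !inE (inj_eq s_inj) (negPf sx) /=.
by rewrite adj_antimorphism // eq_sym.
Qed.

Lemma source_in x : source x \in edge_source.
Proof.
rewrite /source; case: ifPn => // xS.
have sgx : s (g x) != g x.
  rewrite gK; apply: contra xS => /eqP ex.
  by rewrite inE {1}ex gK eqxx.
by apply: contraNT xS => gxS; rewrite -[x]gK antimorphism_edge_source.
Qed.

Lemma source_id x : x \in edge_source -> source x = x.
Proof. by rewrite /source => ->. Qed.

Lemma source_antimorphism x : x \in edge_source -> source (s x) = x.
Proof.
move=> xS; have [ex | sx] := eqVneq (s x) x; first by rewrite ex source_id.
by rewrite /source antimorphism_edge_source // xS sK.
Qed.

Lemma source_cases x : x = source x \/ x = s (source x).
Proof. by rewrite /source; case: ifP; [left | right; rewrite gK]. Qed.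

(** The fibre over [z] lies in [{z, s z}], which is a single vertex or an edge. *)
Lemma adj_source_fiber x y : source x = source y -> x != y -> adj x y.
Proof.
move=> exy; move: (source_cases x) (source_cases y) (source_in y).
rewrite exy inE; move: (source y) => z {exy}.
by move=> [] -> [] -> /orP[/eqP | ] zS; rewrite ?zS ?eqxx // adj_sym zS.
Qed.

(** If [a], [b] are not adjacent, then [s a], [s b] are, and these lie in the same two fibres. *)
Lemma source_adj a b : a \in edge_source -> b \in edge_source -> a != b ->
  exists x y, [/\ source x = a, source y = b & adj x y].
Proof.
move=> aS bS neq_ab; have [ab | nab] := boolP (adj a b).
  by exists a, b; rewrite !source_id.
by exists (s a), (s b); rewrite !source_antimorphism // adj_antimorphism.
Qed.

(** The set and its image under [s] have equal size, cover [G] and share at most one vertex, so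
    twice the size is [#|G|] or [#|G| + 1]. *)
Lemma card_edge_source : #|edge_source| = (#|G| + 1) %/ 2.
Proof.
have cU : #|edge_source :|: s @: edge_source| = #|G|.
  rewrite -cardsT; congr #|pred_of_set _|; apply/setP => x.
  rewrite in_setU in_setT; have xS := source_in x.
  have [-> | ->] := source_cases x; first by rewrite xS.
  by rewrite imset_f ?orbT.
(* A common vertex is fixed by alternation, and [s] would both keep and flip the adjacency of two
   distinct fixed points. *)
have cI : #|edge_source :&: s @: edge_source| <= 1.
  have fixI x : x \in edge_source :&: s @: edge_source -> s x = x.
    case/setIP=> xS /imsetP[y yS ex]; apply/eqP; rewrite ex (inj_eq s_inj).
    by apply/negPn/negP => /antimorphism_edge_source; rewrite -ex xS yS.
  apply/card_le1_eqP => x y /fixI sx /fixI sy; apply/eqP/negPn/negP => neq_xy.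
  by have := adj_antimorphism neq_xy; rewrite sx sy; case: adj.
have := cardsUI edge_source (s @: edge_source).
by rewrite cU card_imset //; lia.
Qed.

End Antimorphism.

Theorem theorem1 (n : nat) (hn : 1 <= n) (G : sgraph) (hG : #|G| = n)
    (hsc : self_complementary G) :
  has_minor G (complete ((n + 1) %/ 2)).
Proof.
case: hsc => /= s [g /= sK gK] s_compl.
have /card_gt0P[x0 _] : 0 < #|G| by rewrite hG.
rewrite -hG -(card_edge_source sK gK s_compl).
(* A witness that [edge_source s] is nonempty, needed to number its elements by [enum_rank_in]. *)
have x0S := source_in sK gK s_compl x0.
pose rk (x : G) : complete _ := enum_rank_in x0S x.
have val_rk x : x \in edge_source s -> enum_val (rk x) = x.
  exact: enum_rankK_in.
have rkK a : rk (enum_val a) = a by exact: enum_valK_in.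
have srcS x := source_in sK gK s_compl x.
apply: (@has_minor_clique_quotient _ _ (fun x => rk (source s g x))).
- by move=> a; exists (enum_val a); rewrite source_id ?rkK ?enum_valP.
- move=> x y /(congr1 enum_val); rewrite !val_rk //.
  exact: (adj_source_fiber sK gK s_compl).
- move=> a b; split=> [/eqP neq_ab | [/eqP //]]; split=> //.
  have neq_v : enum_val a != enum_val b :> G.
    by apply/eqP => /enum_val_inj.
  have [x [y [ex ey xy]]] :=
    source_adj sK s_compl (enum_valP a) (enum_valP b) neq_v.
  by exists x, y; rewrite ex ey !rkK.
Qed.
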